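(* Let $G=(V(G),E(G),w)$ be a connected graph with weight function $w:E(G)\to\mathbb{R}_+$. If $R\in\mathcal{B}(G)$, then $\mathrm{mac}(G)\ge \frac{w(G)+w(R)}{2}$.
   Context: $\mathbb{R}_+$ denotes the non-negative reals. For a subgraph $H$ of $G$, $w(H)=\sum_{e\in E(H)}w(e)$. For a partition $(A,B)$ of $V(G)$, the cut $(A,B)$ is the bipartite subgraph formed by the edges between $A$ and $B$; $\mathrm{mac}(G)$ is the maximum weight of a cut of $G$. $\mathcal{B}(G)$ denotes the set of bipartite subgraphs $R$ of $G$ such that every connected component of $R$ is an induced subgraph of $G$. *)

(* Defs.v *)
From mathcomp Require Import all_boot all_order all_algebra.
From mathcomp Require Import reals.

Set Implicit Arguments.
Unset Strict Implicit.
Unset Printing Implicit Defensive.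

Import Order.TTheory GRing.Theory Num.Theory.
Local Open Scope ring_scope.

(* Finite simple graphs whose vertices are taken in T; an edge is a 2-element
   set of vertices.  The vertex set is a field, rather than all of T, so that
   subgraphs of G are again of type [graph T]. *)
Record graph (T : finType) := Graph {
  vertices : {set T};
  edges : {set {set T}};
  edges_sub : edges \subset [set e in powerset vertices | #|e| == 2%N] }.

Lemma graph_eq (T : finType) (G H : graph T) :
  vertices G = vertices H -> edges G = edges H -> G = H.
Proof.
case: G H => [V E sG] [V' E' sH] /= eqV eqE; subst V' E'.
by rewrite (bool_irrelevance sG sH).
Qed.

Definition subgraph (T : finType) (H G : graph T) : bool :=
  (vertices H \subset vertices G) && (edges H \subset edges G).

Definition induced_subgraph (T : finType) (H G : graph T) : Prop :=
  subgraph H G /\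
  forall e : {set T}, e \in edges G -> e \subset vertices H -> e \in edges H.

Definition adjacent (T : finType) (G : graph T) : rel T :=
  [rel x y | [set x; y] \in edges G].

(* A connected graph is nonempty. *)
Definition connected_graph (T : finType) (G : graph T) : Prop :=
  vertices G != set0 /\
  {in vertices G &, forall x y : T, connect (adjacent G) x y}.

Definition component (T : finType) (C G : graph T) : Prop :=
  [/\ subgraph C G, connected_graph C &
      forall D : graph T,
        subgraph D G -> connected_graph D -> subgraph C D -> D = C].

(* As usual for cuts, a part may be empty: otherwise the one-vertex graph would
   have no cut. *)
Definition bipartition (T : finType) (G : graph T) (A B : {set T}) : bool :=
  (A :|: B == vertices G) && [disjoint A & B].

Definition edges_between (T : finType) (A B : {set T}) : {set {set T}} :=
  [set [set x; y] | x in A, y in B].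

Definition bipartite (T : finType) (G : graph T) : Prop :=
  exists A B : {set T}, bipartition G A B /\ edges G \subset edges_between A B.

Lemma cut_edges_sub (T : finType) (G : graph T) (A B : {set T}) :
  edges G :&: edges_between A B
    \subset [set e in powerset (vertices G) | #|e| == 2%N].
Proof. exact: subset_trans (subsetIl _ _) (edges_sub G). Qed.

Definition cut (T : finType) (G : graph T) (A B : {set T}) : graph T :=
  Graph (cut_edges_sub G A B).

(* A weight is a function on all sets of vertices, of which only the values on
   edges are ever used. *)
Definition weight (R : realType) (T : finType) (w : {set T} -> R)
    (G : graph T) : R :=
  \sum_(e in edges G) w e.

(* The initial value 0 does not affect the maximum when w is nonnegative on the
   edges, and it is attained by the cut (V(G), set0). *)
Definition mac (R : realType) (T : finType) (w : {set T} -> R)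
    (G : graph T) : R :=
  \big[Num.max/0]_(P : {set T} * {set T} | bipartition G P.1 P.2)
    weight w (cut G P.1 P.2).

(* H belongs to the family B(G). *)
Definition calB (T : finType) (G H : graph T) : Prop :=
  [/\ subgraph H G, bipartite H &
      forall C : graph T, component C H -> induced_subgraph C G].

(* Main.v *)
(* Fix a bipartition (X, Y) of R and, independently for each component of R,
   exchange its two sides or not with probability 1/2; a vertex outside R counts
   as a component of its own.  Edges of R are always cut.  Components of R being
   induced in G, an edge of G outside R joins two different components, hence is
   cut with probability 1/2.  So the expected weight of the cut is
   w(R) + (w(G) - w(R)) / 2. *)
Require Import Defs.
From mathcomp Require Import all_boot all_order all_algebra.
From mathcomp Require Import reals.

Set Implicit Arguments.
Unset Strict Implicit.
Unset Printing Implicit Defensive.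

Import Order.TTheory GRing.Theory Num.Theory.
Local Open Scope ring_scope.

(** An injective self-map of a finite type is a bijection. Reindexing one of two copies of the sum
    by [g] pairs [b i] with its negation, so each [i] contributes exactly 1. This replaces
    probability 1/2 by counting. *)
Lemma sum_flip (I : finType) (g : I -> I) (b : pred I) :
  injective g -> (forall i, b (g i) = ~~ b i) ->
  ((\sum_i b i).*2 = #|I|)%N.
Proof.
move=> g_inj bg; rewrite -addnn {2}(reindex_inj g_inj) /= -big_split /=.
rewrite (eq_bigr (fun=> 1%N)) ?sum1_card // => i _.
by rewrite bg; case: (b i).
Qed.

Section Graphs.
Variable T : finType.
Implicit Types (G R : graph T) (X Y e : {set T}).

Lemma edge_sub_vertices G e : e \in edges G -> e \subset vertices G.
Proof. by move/(subsetP (edges_sub G)); rewrite inE powersetE => /andP[]. Qed.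

Lemma edgeP G e : e \in edges G ->
  exists x y, [/\ x != y, e = [set x; y], x \in vertices G & y \in vertices G].
Proof.
move=> eG; have /subsetP sub := edge_sub_vertices eG.
move/(subsetP (edges_sub G)): eG; rewrite inE => /andP[_ /cards2P[x [y [xy eE]]]].
by exists x, y; split=> //; apply: sub; rewrite eE !inE eqxx ?orbT.
Qed.

Lemma adjacent_sym G : symmetric (adjacent G).
Proof. by move=> x y; rewrite /adjacent /= setUC. Qed.

Lemma connect_adjacent_sym G : connect_sym (adjacent G).
Proof. exact/sym_connect_sym/adjacent_sym. Qed.

Lemma connect_adjacentW G R x y : edges R \subset edges G ->
  connect (adjacent R) x y -> connect (adjacent G) x y.
Proof.
move=> /subsetP sRG; apply: connect_sub => {}x {}y xy.
exact/connect1/sRG.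
Qed.

Definition component_vertices G x :=
  [set y in vertices G | connect (adjacent G) x y].

Lemma component_edges_sub G x :
  [set e in edges G | e \subset component_vertices G x]
    \subset [set e in powerset (component_vertices G x) | #|e| == 2%N].
Proof.
apply/subsetP=> e; rewrite !inE => /andP[eG ->] /=.
by move/(subsetP (edges_sub G)): eG; rewrite inE => /andP[].
Qed.

Definition component_of G x : graph T := Graph (component_edges_sub G x).

Lemma path_component_of G x y p :
  y \in component_vertices G x -> path (adjacent G) y p ->
  path (adjacent (component_of G x)) y p.
Proof.
elim: p y => //= z p IHp y yC /andP[yz zp].
have zC : z \in component_vertices G x.
  move: yC; rewrite !inE => /andP[_ xy].
  rewrite (subsetP (edge_sub_vertices yz)) ?inE ?eqxx ?orbT //=.
  exact: connect_trans xy (connect1 yz).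
rewrite IHp // andbT /adjacent /= inE [_ \in edges G]yz /=.
by rewrite subUset !sub1set yC zC.
Qed.

Lemma component_ofP G x : x \in vertices G -> component (component_of G x) G.
Proof.
move=> xG; have xC : x \in component_vertices G x by rewrite inE xG connect0.
split.
- apply/andP; split; apply/subsetP=> z; rewrite inE => /andP[] //.
- split; first by apply/set0Pn; exists x.
  move=> y z yC zC; have : connect (adjacent G) y z.
    move: yC zC; rewrite !inE => /andP[_ xy] /andP[_ xz].
    by rewrite (connect_trans _ xz) // connect_adjacent_sym.
  move=> /connectP[p yp ->]; apply/connectP; exists p => //.
  exact: path_component_of.
(* Maximality: [D] contains [x] and is connected inside [G], so all its vertices are reachable from
   [x]. *)
- move=> D /andP[sVD sED] [_ cD] /andP[/= sCD /subsetP sCE].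
  have VD : vertices D = component_vertices G x.
    apply/eqP; rewrite eqEsubset sCD andbT; apply/subsetP=> y yD.
    rewrite inE (subsetP sVD) //=; apply: connect_adjacentW sED _.
    by apply: cD => //; apply: (subsetP sCD).
  apply: graph_eq => //=; apply/setP=> e; apply/idP/idP; last exact: sCE.
  by move=> eD; rewrite inE (subsetP sED) //= -VD edge_sub_vertices.
Qed.

(** Both ends lie in the component of [x] in [R], which is induced in [G] and hence contains the
    edge. *)
Lemma calB_edge G R x y : calB G R -> x != y -> [set x; y] \in edges G ->
  connect (adjacent R) x y -> [set x; y] \in edges R.
Proof.
move=> [_ _ indR] xDy xyG xy.
(* [connect] is reflexive on all of [T], so membership in [R] has to come from the first edge of a
   nontrivial path. *)
have endR u v : u != v -> connect (adjacent R) u v -> u \in vertices R.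
  move=> uv /connectP[[/= _ vE|z p /= /andP[uz _] _]].
    by rewrite vE eqxx in uv.
  by rewrite (subsetP (edge_sub_vertices uz)) ?inE ?eqxx.
have xR := endR _ _ xDy xy.
have yR : y \in vertices R.
  by apply: (endR _ x); rewrite 1?eq_sym // connect_adjacent_sym.
have [_ /(_ _ xyG)] := indR _ (component_ofP xR).
by rewrite subUset !sub1set !inE xR yR connect0 xy => /(_ isT)/andP[].
Qed.

Lemma in_edges_between_split (V : {set T}) (s : pred T) x y :
  x \in V -> y \in V ->
  ([set x; y] \in edges_between [set z in V | s z] [set z in V | ~~ s z])
    = (s x != s y).
Proof.
move=> xV yV; apply/imset2P/idP => [[a b]|].
  rewrite !inE => /andP[_ sa] /andP[_ sb] /setP E.
  have := E a; have := E b; rewrite !inE !eqxx orbT /=.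
  by case/orP=> /eqP eb; case/orP=> /eqP ea; move: sa sb; rewrite ea eb;
     case: (s x); case: (s y).
case sx: (s x); case sy: (s y) => // _.
  by exists x y; rewrite ?inE ?xV ?yV ?sx ?sy.
by exists y x; rewrite ?inE ?xV ?yV ?sx ?sy // setUC.
Qed.

Lemma bipartition_split G (s : pred T) :
  bipartition G [set z in vertices G | s z] [set z in vertices G | ~~ s z].
Proof.
apply/andP; split.
  by apply/eqP/setP=> z; rewrite !inE -andb_orr orbN andbT.
rewrite -setI_eq0; apply/eqP/setP=> z; rewrite !inE.
by case: (z \in _); case: (s z).
Qed.

(** There is one coin per element of [T], but a vertex reads only the coin at the root of its
    component, so a whole component is exchanged or kept together. *)
Definition side R (X : {set T}) (f : {ffun T -> bool}) : pred T :=
  fun x => f (fingraph.root (adjacent R) x) (+) (x \in X).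

Definition separates G R X f e :=
  e \in edges_between [set z in vertices G | side R X f z]
                      [set z in vertices G | ~~ side R X f z].

(** The two ends share a root, hence a coin, and exactly one of them is in [X]. *)
Lemma separates_edge G R X Y f e :
  subgraph R G -> [disjoint X & Y] -> edges R \subset edges_between X Y ->
  e \in edges R -> separates G R X f e.
Proof.
move=> /andP[_ /subsetP sRG] disXY /subsetP sXY eR.
have /subsetP eV := edge_sub_vertices (sRG _ eR).
have /imset2P[x y xX yY eE] := sXY _ eR; subst e.
rewrite /separates in_edges_between_split ?eV ?inE ?eqxx ?orbT //.
have xy : connect (adjacent R) x y by exact: connect1.
have yX : y \in X = false := disjointFl disXY yY.
rewrite /side (fingraph.rootP (@connect_adjacent_sym R) xy) xX yX.
by case: (f _).
Qed.

Lemma sum_separates G R X e :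
  calB G R -> e \in edges G -> e \notin edges R ->
  ((\sum_(f : {ffun T -> bool}) separates G R X f e).*2
     = #|{ffun T -> bool}|)%N.
Proof.
move=> RB eG eR; have [x [y [xDy eE xV yV]]] := edgeP eG; subst e.
set r := fingraph.root (adjacent R).
have rxy : r y != r x.
  apply/negP=> /eqP/(fingraph.rootP (@connect_adjacent_sym R)).
  rewrite connect_adjacent_sym => /(calB_edge RB xDy eG).
  exact/negP.
(* The ends have different roots, so flipping the coin at the root of [x] moves [x] to the other
   side and leaves [y] in place. *)
pose g (f : {ffun T -> bool}) := [ffun z => f z (+) (z == r x)].
apply: (@sum_flip _ g) => [|f].
  by apply: (can_inj (g := g)) => f; apply/ffunP=> z; rewrite !ffunE addbK.
rewrite /separates !in_edges_between_split // /side !ffunE -/r eqxx.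
rewrite (negPf rxy) addbF.
by case: (f _); case: (f _); case: (x \in X); case: (y \in X).
Qed.

End Graphs.

Theorem theorem2p1 (K : realType) (T : finType) (G : graph T)
    (w : {set T} -> K)
    (w_ge0 : forall e : {set T}, e \in edges G -> 0 <= w e)
    (G_connected : connected_graph G)
    (R : graph T) (R_in_B : calB G R) :
  mac w G >= (weight w G + weight w R) / 2.
Proof.
have [sRG [X [Y [/andP[_ disXY] sXY]]] _] := R_in_B.
have /andP[_ /setIidPr sE] := sRG.
pose F := {ffun T -> bool}.
have cut_le (f : F) :
    \sum_(e in edges G) w e *+ separates G R X f e <= mac w G.
  apply: le_trans (le_bigmax_cond _ (fun P => weight w (cut G P.1 P.2))
    (bipartition_split G (side R X f) : (fun P => bipartition G P.1 P.2) (_, _))).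
  rewrite /weight /= [leRHS](eq_bigl _ _ (fun e => in_setI _ _ _)) big_mkcondr.
  by apply: ler_sum => e _; rewrite -mulrb.
have N_gt0 : (0 < #|{: F}|)%N by apply/card_gt0P; exists [ffun=> false].
(* The expectation is cleared of denominators: everything is multiplied by 2 and by the number of
   coin assignments. *)
rewrite ler_pdivrMr // -(ler_pMn2r N_gt0).
have -> : (weight w G + weight w R) *+ #|{: F}|
    = (\sum_(f : F) \sum_(e in edges G) w e *+ separates G R X f e) * 2.
  (* Edge by edge: an edge of [R] is cut by every assignment and is counted in both weights; any
     other edge of [G] is cut by half of them and is counted once. *)
  rewrite exchange_big /= {2}/weight -sE (eq_bigl _ _ (fun e => in_setI _ _ _)).
  rewrite big_mkcondr -big_split /= -sumrMnl mulr_suml.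
  apply: eq_bigr => e eG; rewrite sumrMnr mulr_natr -mulrnA muln2.
  case: ifPn => eR; last by rewrite addr0 (sum_separates X R_in_B eG eR).
  rewrite (eq_bigr (fun=> 1%N)) => [|f _].
    by rewrite sum1_card -mulr2n -mulrnA mul2n.
  by rewrite (separates_edge f sRG disXY sXY eR).
(* Each of the cuts summed has weight at most [mac w G]. *)
rewrite -mulrnAl ler_pM2r //.
rewrite -[leRHS]sumr_const; exact: ler_sum.
Qed.
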